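(* For any $s\in\mathbb{N}$, any $a_1,\dots,a_s\in[0,2\pi)$ and any $\epsilon>0$, there exist infinitely many $p\in\mathbb{N}$ such that $|p a_i\ (\mathrm{mod}\ 2\pi)|<\epsilon$ $(i=1,\dots,s)$.
   Context: Here ''mod'' indicates the modulo operation: for a real number $x$, the symbol $x\ (\mathrm{mod}\ 2\pi)$ stands for the remainder after $x$ is divided by $2\pi$. $\mathbb{N}$ denotes the set of natural numbers (positive integers).
   Formalization: The remainder x (mod 2π) is taken as the signed one in [−π, π), so |x (mod 2π)| is the distance to the nearest multiple of 2π; with remainders in [0, 2π) the claim fails, e.g. for a_2 = 2π − a_1 with a_1/(2π) irrational. *)

(* Defs.v *)
From HB Require Import structures.
From mathcomp Require Import all_boot all_order all_algebra.
From mathcomp Require Import all_classical all_reals all_analysis.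
From mathcomp Require Import ring lra.

Set Implicit Arguments.
Unset Strict Implicit.
Unset Printing Implicit Defensive.

Import Order.TTheory GRing.Theory Num.Theory.
Local Open Scope ring_scope.

(* Signed remainder of x after division by 2 pi: the quotient is rounded to the
   nearest integer, so the remainder lies in [- pi, pi[.  With remainders in
   [0, 2 pi[ instead, simultaneous smallness of the residues of p * a and
   p * (2 pi - a) would force p * a to be an exact multiple of 2 pi. *)
Definition mod2pi (R : realType) (x : R) : R :=
  x - (Num.floor (x / (2 * pi) + 2^-1))%:~R * (2 * pi).

Lemma mod2pi_congr (R : realType) (x : R) :
  exists k : int, x = k%:~R * (2 * pi) + mod2pi x.
Proof.
by exists (Num.floor (x / (2 * pi) + 2^-1)); rewrite /mod2pi addrC subrK.
Qed.

Lemma mod2pi_itv (R : realType) (x : R) : - pi <= mod2pi x < pi.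
Proof.
have pi0 : 0 < pi :> R := pi_gt0 R.
have /andP[] := floor_itv (x / (2 * pi) + 2^-1).
rewrite intrD /mod2pi; set n := (Num.floor _)%:~R => nl nu.
have xE : x = x / (2 * pi) * (2 * pi) by rewrite divfK ?mulf_neq0 ?gt_eqF.
set y := x / (2 * pi) in nl nu xE; rewrite xE.
by apply/andP; split; nra.
Qed.

(* Main.v *)
Require Import Defs.
From HB Require Import structures.
From mathcomp Require Import all_boot all_order all_algebra.
From mathcomp Require Import all_classical all_reals all_analysis.
From mathcomp Require Import ring lra.

(** This is Dirichlet's theorem on simultaneous approximation, for the angles
    [t i = a i / (2 * pi)] measured in full turns.  Cut the unit cube into
    [m ^ s] cells of side [1 / m].  Among the multiples [j * t] with
    [0 <= j <= m ^ s], two have their fractional parts in the same cell, so the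
    difference [p] of the two factors [j] brings every [p * t i] within [1 / m]
    of an integer ([simultaneous_approximation]).  The [p] obtained in this way
    need not grow with [m] (for instance if all [t i] are rational); applying
    the result to [q * t] with [q] a large integer, and replacing [p] by
    [p * q], yields suitable multipliers beyond any bound, hence infinitely
    many.

    Up to sign, the residue [mod2pi x] is the distance from [x] to the nearest
    multiple of [2 * pi] ([normr_mod2pi_le]), so a good integer approximation
    of [p * t i] bounds the residue of [p * a i]. *)

Set Implicit Arguments.
Unset Strict Implicit.
Unset Printing Implicit Defensive.

Import Order.TTheory GRing.Theory Num.Theory.
Local Open Scope classical_set_scope.
Local Open Scope ring_scope.

(** Any multiple of [2 * pi] other than the one subtracted in [mod2pi x] is at
    distance at least [2 * pi - pi] from [x], while [mod2pi x] has absolute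
    value at most [pi]. *)
Lemma normr_mod2pi_le (R : realType) (x : R) (n : int) :
  `|mod2pi x| <= `|x - n%:~R * (2 * pi)|.
Proof.
have pi0 : 0 < pi :> R := pi_gt0 R.
have [k xE] := mod2pi_congr x; have /andP[ml mu] := mod2pi_itv x.
set r := mod2pi x in xE ml mu *.
have -> : x - n%:~R * (2 * pi) = r + (k - n)%:~R * (2 * pi).
  by rewrite {1}xE intrB; ring.
have r_le : `|r| <= pi by rewrite ler_norml ml ltW.
have [d0|d0|->] := ltgtP (k - n) 0; last by rewrite mul0r addr0.
- have d1 : (k - n)%:~R <= -1 :> R by rewrite (ler_int _ _ (-1)) -ltzD1.
  apply: (le_trans r_le); rewrite -normrN; apply: le_trans (ler_norm _).
  by nra.
- have d1 : 1 <= (k - n)%:~R :> R by rewrite (ler_int _ 1).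
  by apply: (le_trans r_le); apply: le_trans (ler_norm _); nra.
Qed.

(** The pigeonholes: cutting [0, 1[ into [m] intervals of length [1 / m], this
    is the number of the interval that contains the fractional part of [x]. *)
Lemma truncn_scaled_frac_lt (R : archiRealFieldType) (m : nat) (x : R) :
  (0 < m)%N ->
  (Num.truncn (m%:R * (x - (Num.floor x)%:~R)) < m)%N.
Proof.
move=> m0; have /andP[fl fu] := floor_itv x; rewrite intrD in fu.
have m0R : 0 < m%:R :> R by rewrite ltr0n.
have y0 : 0 <= m%:R * (x - (Num.floor x)%:~R).
  by rewrite mulr_ge0 ?ler0n ?subr_ge0.
by rewrite truncn_lt_nat //; nra.
Qed.

(** The pigeonhole argument: there are [m ^ s] cells for [m ^ s + 1] values of
    [j]. If [j * t] and [k * t] share a cell, their fractional parts differ by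
    less than [1 / m] in each coordinate, and the integer near
    [(k - j) * t i] is the difference of the integer parts. *)
Lemma simultaneous_approximation (R : archiRealFieldType) (s m : nat)
    (t : 'I_s -> R) :
  (0 < m)%N ->
  exists2 p : nat, (0 < p)%N &
    forall i, exists n : int, `|p%:R * t i - n%:~R| < m%:R^-1.
Proof.
move=> m0; have m0R : 0 < m%:R :> R by rewrite ltr0n.
pose cell (j : 'I_(m ^ s).+1) : {ffun 'I_s -> 'I_m} :=
  [ffun i => Ordinal (truncn_scaled_frac_lt (j%:R * t i) m0)].
have [j [k jk cell_jk]] : exists j : 'I_(m ^ s).+1,
    exists2 k : 'I_(m ^ s).+1, (j < k)%N & cell j = cell k.
  have /injectivePn[j [k jk cell_jk]] : ~~ injectiveb cell.
    by apply/injectiveP => /leq_card; rewrite card_ffun !card_ord ltnn.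
  have [lt_jk|lt_kj|/val_inj eq_jk] := ltngtP j k.
  - by exists j, k.
  - by exists k, j.
  - by rewrite eq_jk eqxx in jk.
exists (k - j)%N; first by rewrite subn_gt0.
move=> i; exists (Num.floor (k%:R * t i) - Num.floor (j%:R * t i)).
have /(congr1 val) /= := congr1 (fun f : {ffun _ -> _} => f i) cell_jk.
rewrite !ffunE /= natrB 1?ltnW // intrB.
have ge0 (x : R) : 0 <= m%:R * (x - (Num.floor x)%:~R).
  by rewrite mulr_ge0 ?ler0n ?subr_ge0 ?ge_floor.
have /andP[] := truncn_itv (ge0 (j%:R * t i)).
have /andP[] := truncn_itv (ge0 (k%:R * t i)).
rewrite -!natr1 => kl ku jl ju trE; rewrite trE in jl ju.
rewrite -[_^-1]mul1r ltr_pdivlMr // -[X in _ * X](gtr0_norm m0R) -normrM.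
by rewrite ltr_norml; apply/andP; split; nra.
Qed.

Lemma infinite_set_nat_unbounded (A : set nat) :
  (forall b : nat, exists2 p, A p & (b < p)%N) -> infinite_set A.
Proof.
move=> unbA /finite_seqP[r AE].
have [p Ap] := unbA (\max_(i <- r) i)%N.
by rewrite AE in Ap; rewrite ltnNge (@leq_bigmax_seq _ r xpredT id).
Qed.

Theorem lemma8 (R : realType) (s : nat) (hs : (0 < s)%N)
    (a : 'I_s -> R) (ha : forall i : 'I_s, 0 <= a i < 2 * pi)
    (eps : R) (heps : 0 < eps) :
  infinite_set
    [set p : nat | (0 < p)%N /\
       forall i : 'I_s, `|mod2pi (p%:R * a i)| < eps].
Proof.
have pi20 : 0 < 2 * pi :> R by rewrite mulr_gt0 ?pi_gt0.
apply: infinite_set_nat_unbounded => b.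
(* With this m, an error of 1 / m turn is an angle below eps. *)
pose m := Num.bound (2 * pi / eps).
have m_gt : 2 * pi / eps < m%:R by rewrite archi_boundP // divr_ge0 ?ltW.
have m0R : 0 < m%:R :> R by apply: lt_trans m_gt; rewrite divr_gt0.
have m0 : (0 < m)%N by rewrite -(ltr0n R).
have [p p0 p_approx] :=
  simultaneous_approximation (fun i => b.+1%:R * (a i / (2 * pi))) m0.
exists (p * b.+1)%N; last by rewrite leq_pmull.
split=> [|i]; first by rewrite muln_gt0 p0.
have [n n_approx] := p_approx i.
apply: le_lt_trans (normr_mod2pi_le _ n) _.
have -> : (p * b.+1)%:R * a i - n%:~R * (2 * pi) =
    (p%:R * (b.+1%:R * (a i / (2 * pi))) - n%:~R) * (2 * pi).
  by rewrite natrM mulrBl -!mulrA mulVf ?mulr1 ?gt_eqF.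
rewrite normrM (gtr0_norm pi20).
apply: (@lt_trans _ _ (m%:R^-1 * (2 * pi))); first by rewrite ltr_pM2r.
by rewrite ltr_pdivrMl // -ltr_pdivrMr.
Qed.
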